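(* Let $(b,c)$ be a connected graph over $X$. (a) If $b$ is recurrent and $c\neq0$, then every bounded harmonic function (for $(b,c)$) is zero. (b) If $b$ is transient and $c\in\ell^1(X)$, then there exist non-zero bounded harmonic functions (for $(b,c)$).
   Context: Let $X$ be a countable set. A graph $(b,c)$ over $X$ consists of a symmetric function $b:X\times X\to[0,\infty)$ with $b(x,x)=0$ and $\sum_{y\in X}b(x,y)<\infty$ for all $x\in X$, and a function $c:X\to[0,\infty)$ (the killing term); one writes $b$ for $(b,0)$. The graph is connected if for all $x,y\in X$ there are $x=y_1,\dots,y_{n+1}=y$ with $b(y_i,y_{i+1})>0$ for $1\le i\le n$. Let $\mathcal{F}=\{f:X\to\mathbb{R}\mid \sum_y b(x,y)|f(y)|<\infty \text{ for all }x\}$ and, for $f\in\mathcal{F}$, $\mathcal{L}f(x)=\mathcal{L}_{b,c}f(x)=\sum_y b(x,y)(f(x)-f(y))+c(x)f(x)$. A function $u\in\mathcal{F}$ is harmonic for $(b,c)$ if $\mathcal{L}_{b,c}u=0$ on $X$. Let $\mathcal{Q}(f)=\frac12\sum_{x,y}b(x,y)(f(x)-f(y))^2+\sum_x c(x)f(x)^2$, $\mathcal{D}=\{f:X\to\mathbb{R}\mid\mathcal{Q}(f)<\infty\}$, and let $\mathcal{D}_0$ be the closure of the finitely supported functions in $\mathcal{D}$ with respect to $\|f\|_o=\sqrt{\mathcal{Q}(f)+|f(o)|^2}$ for a fixed $o\in X$. A connected graph $(b,c)$ is transient if for every $y\in X$ there is a unique $G_y\in\mathcal{D}_0$ with $\mathcal{L}G_y=1_{\{y\}}$,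 and recurrent otherwise. ''$b$ is transient/recurrent'' means that $(b,0)$ is transient/recurrent. *)

(* Defs.v *)
From HB Require Import structures.
From mathcomp Require Import all_boot all_order all_algebra.
From mathcomp Require Import all_classical all_reals all_analysis.

Set Implicit Arguments.
Unset Strict Implicit.
Unset Printing Implicit Defensive.

Import Order.TTheory GRing.Theory Num.Theory.
Import numFieldNormedType.Exports.

Local Open Scope classical_set_scope.
Local Open Scope ring_scope.

Section Graphs.
Context {R : realType} {X : countType}.
Implicit Types (b : X -> X -> R) (c f g : X -> R).

Definition is_graph b c : Prop :=
  [/\ forall x y, b x y = b y x,
      forall x y, 0 <= b x y,
      forall x, b x x = 0,
      forall x, (\esum_(y in [set: X]) (b x y)%:E < +oo)%E
    & forall x, 0 <= c x].

(* [p] lists the vertices after the starting point [x]; the trivial path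
   [p = [::]] is allowed, so that a single vertex is a connected graph. *)
Definition connected_graph b : Prop :=
  forall x y, exists2 p : seq X, path (fun u v => 0 < b u v) x p & last x p = y.

(* Unordered sum of a real family; it is the actual sum when the family is
   absolutely summable, and is only meaningful in that case. *)
Definition tsum g : R :=
  fine ((\esum_(y in [set: X]) (EFin \o g)^\+ y) -
        (\esum_(y in [set: X]) (EFin \o g)^\- y))%E.

Definition laplacian_domain b f : Prop :=
  forall x, summable [set: X] (fun y => (b x y * `|f y|)%:E).

(* Only meaningful on [laplacian_domain b], where the sum converges absolutely. *)
Definition laplacian b c f (x : X) : R :=
  tsum (fun y => b x y * (f x - f y)) + c x * f x.

Definition harmonic_fun b c f : Prop :=
  laplacian_domain b f /\ forall x, laplacian b c f x = 0.

Definition energy b c f : \bar R :=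
  (((2^-1)%:E *
      (\esum_(p in [set: X * X]) (b p.1 p.2 * (f p.1 - f p.2) ^+ 2)%:E))
   + (\esum_(x in [set: X]) (c x * f x ^+ 2)%:E))%E.

Definition finite_energy b c f : Prop := (energy b c f < +oo)%E.

Definition norm_at b c (o : X) f : \bar R :=
  sqrte (energy b c f + (`|f o| ^+ 2)%:E)%E.

Definition finitely_supported f : Prop := finite_set [set x | f x != 0].

Definition finite_energy0 b c (o : X) f : Prop :=
  finite_energy b c f /\
  forall e : R, 0 < e ->
    exists2 phi : X -> R, finitely_supported phi
                        & (norm_at b c o (fun x => f x - phi x)%R < e%:E)%E.

(* Transience and recurrence are meant for connected graphs. *)
Definition transient b c (o : X) : Prop :=
  forall y, exists! G : X -> R,
    [/\ finite_energy0 b c o G, laplacian_domain b G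
      & forall x, laplacian b c G x = (x == y)%:R].

Definition recurrent b c (o : X) : Prop := ~ transient b c o.

End Graphs.

(* Main.v *)
(** Everything is driven by the capacity inequality: a vertex [x] is
    point-bounded if [phi x ^ 2 <= C * Q phi] for all finitely supported [phi].
    Under it, minimizing [Q phi - 2 * ell phi] over finitely supported [phi], for
    a linear functional [ell], yields a sequence that is Cauchy in energy (compare
    with midpoints) and pointwise (capacity); its limit [g] solves
    [L g x = ell (delta x)].  With [ell = evaluation at y] this produces Green
    functions, so that transience is equivalent to the capacity inequality.

    (a) If [u] is bounded, harmonic for [(b, c)] and non-zero, then
    [s = M ^ 2 + 1 - u ^ 2] satisfies
    [L_b s x = \sum_y b x y * (u x - u y) ^ 2 + 2 * c x * u x ^ 2 >= 0], with a
    strict inequality somewhere since [c] is non-zero.  Testing against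
    [phi ^ 2 / s] gives the capacity inequality for [b], which is thus transient.

    (b) If [b] is transient and [c] is summable, minimize for
    [ell phi = \sum_x c x * phi x].  Up to a constant the functional is the energy
    of [1 - phi], so minimizing sequences can be truncated to [0, 1] and
    [u = 1 - g] is bounded and harmonic.  If [u] vanished, finitely supported
    functions would converge to [1] with energies tending to [0], against the
    capacity inequality. *)
Require Import Defs.
From HB Require Import structures.
From mathcomp Require Import all_boot all_order all_algebra.
From mathcomp Require Import all_classical all_reals all_analysis.
From mathcomp Require Import ring lra.

Import Order.TTheory GRing.Theory Num.Theory.
Import numFieldNormedType.Exports.

Local Open Scope classical_set_scope.
Local Open Scope ring_scope.

(** * Unordered sums of real families *)

Section UnorderedSums.
Context {R : realType}.

Definition absum {T : countType} (f : T -> R) : Prop :=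
  summable [set: T] (EFin \o f).

Context {T : countType}.
Implicit Types f g : T -> R.

Lemma absumE f : absum f = (\esum_(x in [set: T]) (`|f x|%:E) < +oo)%E.
Proof. by []. Qed.

Lemma absum_le f g : absum g -> (forall x, `|f x| <= g x) -> absum f.
Proof.
move=> gs fg; rewrite absumE; apply: le_lt_trans gs.
apply: le_esum => x _ /=; rewrite lee_fin.
by rewrite (le_trans (fg x)) ?ler_norm.
Qed.

Lemma absumD {f g} : absum f -> absum g -> absum (fun x => f x + g x).
Proof. exact: summableD. Qed.

Lemma absumN {f} : absum f -> absum (fun x => - f x).
Proof. by rewrite /absum summableN. Qed.

Lemma absum_norm {f} : absum f -> absum (fun x => `|f x|).
Proof.
by rewrite !absumE; under [X in _ -> (X < _)%E]eq_esum do rewrite normr_id.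
Qed.

Lemma ge0_esumZ_le (a : R) f : 0 <= a -> (forall x, 0 <= f x) ->
  (\esum_(x in [set: T]) (a * f x)%:E <= a%:E * \esum_(x in [set: T]) (f x)%:E)%E.
Proof.
move=> a0 f0; apply: ge_ereal_sup => _ [F [finF _] <-].
under eq_fsbigr do rewrite EFinM.
rewrite -ge0_mule_fsumr//.
apply: lee_wpmul2l; first by rewrite lee_fin.
apply: ereal_sup_ubound.
by exists F.
Qed.

(** The reverse inequality is [ge0_esumZ_le] applied with [a^-1]. The case [a = 0] is treated apart,
    since the sum may be infinite and then [0 * +oo = 0] is used. *)
Lemma ge0_esumZ (a : R) f : 0 <= a -> (forall x, 0 <= f x) ->
  (\esum_(x in [set: T]) (a * f x)%:E = a%:E * \esum_(x in [set: T]) (f x)%:E)%E.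
Proof.
move=> a0 f0; apply/eqP; rewrite eq_le ge0_esumZ_le//=.
have [a_eq0|a_neq0] := eqVneq a 0; last have {}a0 : 0 < a by rewrite lt_neqAle eq_sym a_neq0.
  rewrite a_eq0.
  by rewrite mul0e; apply: esum_ge0 => x _; rewrite mul0r.
rewrite -lee_pdivlMl//.
rewrite (@eq_esum _ _ _ (EFin \o f) (fun x => (a^-1 * (a * f x))%:E)) => [|x _].
  by apply: ge0_esumZ_le => [|x]; [rewrite invr_ge0 ltW|exact: mulr_ge0 (ltW a0) (f0 x)].
by rewrite mulKf.
Qed.

Lemma absumZ (a : R) {f} : absum f -> absum (fun x => a * f x).
Proof.
rewrite !absumE => fs.
rewrite (@eq_esum _ _ _ _ (fun x => (`|a| * `|f x|)%:E)) => [|x _]; last first.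
  by rewrite normrM.
rewrite ge0_esumZ//; exact: lte_mul_pinfty.
Qed.

Lemma absumB {f g} : absum f -> absum g -> absum (fun x => f x - g x).
Proof. by move=> fs gs; apply: absumD fs (absumN gs). Qed.

Lemma eq_tsum f g : f =1 g -> tsum f = tsum g.
Proof. by move=> /funext ->. Qed.

Lemma esum_tsum f : absum f -> (forall x, 0 <= f x) ->
  (\esum_(x in [set: T]) (f x)%:E = (tsum f)%:E)%E.
Proof.
move=> fs f0; rewrite /tsum.
rewrite [X in (_ - X)%E]esum1 => [|x _]; last first.
  by rewrite (@ge0_funenegE _ _ setT) ?inE// => y _; rewrite lee_fin.
rewrite sube0 -[X in fine X](@eq_esum _ _ _ (EFin \o f)) => [|x _]; last first.
  by rewrite (@ge0_funeposE _ _ setT) ?inE// => y _; rewrite lee_fin.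
rewrite fineK//; move: fs; rewrite /absum summableE.
by under eq_esum do rewrite /= ger0_norm//.
Qed.

Lemma tsum_ge0 f : absum f -> (forall x, 0 <= f x) -> 0 <= tsum f.
Proof.
by move=> fs f0; rewrite -lee_fin -esum_tsum//; apply: esum_ge0 => x _; rewrite lee_fin.
Qed.

Lemma ge0_tsumD f g : absum f -> absum g -> (forall x, 0 <= f x) ->
  (forall x, 0 <= g x) -> tsum (fun x => f x + g x) = tsum f + tsum g.
Proof.
move=> fs gs f0 g0; apply: EFin_inj; rewrite EFinD.
rewrite -!esum_tsum -?esumD//.
- by move=> x _; rewrite lee_fin.
- by move=> x _; rewrite lee_fin.
- exact: absumD.
- by move=> x; rewrite addr_ge0.
Qed.

Lemma ge0_tsumB f g : absum f -> absum g -> (forall x, 0 <= f x) ->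
  (forall x, 0 <= g x) -> tsum (fun x => f x - g x) = tsum f - tsum g.
Proof.
move=> fs gs f0 g0; rewrite {1}/tsum.
have := @esumB R T setT (EFin \o f) (EFin \o g) fs gs.
rewrite /= !esum_tsum// => H.
by rewrite [X in fine X]H// => x _; rewrite lee_fin.
Qed.

Let pos f x := Num.max (f x) 0.
Let neg f x := Num.max (- f x) 0.

Let posneg f x : f x = pos f x - neg f x.
Proof. rewrite /pos /neg; case: (leP (f x) 0); case: (leP (- f x) 0); lra. Qed.

Let absum_pos {f} : absum f -> absum (pos f).
Proof.
move=> /absum_norm fs; apply: absum_le fs _ => x.
by rewrite ger0_norm /pos ?le_max ?lexx ?orbT// ge_max ler_norm normr_ge0.
Qed.

Let absum_neg {f} : absum f -> absum (neg f).
Proof. by move=> /absumN/absum_pos. Qed.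

Let pos_ge0 f x : 0 <= pos f x. Proof. by rewrite le_max lexx orbT. Qed.
Let neg_ge0 f x : 0 <= neg f x. Proof. by rewrite le_max lexx orbT. Qed.

Let tsum_posneg {f} : absum f -> tsum f = tsum (pos f) - tsum (neg f).
Proof.
move=> fs; rewrite -ge0_tsumB//; [|exact: absum_pos|exact: absum_neg].
exact: eq_tsum.
Qed.

(** [pos f + pos g] and [neg f + neg g] need not be the positive and negative parts of [f + g];
    [ge0_tsumB] applies because it accepts any difference of non-negative summable families. *)
Lemma tsumD {f g} : absum f -> absum g ->
  tsum (fun x => f x + g x) = tsum f + tsum g.
Proof.
move=> fs gs; have [fp gp] := (absum_pos fs, absum_pos gs).
have [fn gn] := (absum_neg fs, absum_neg gs).
rewrite (@eq_tsum _ (fun x => (pos f x + pos g x) - (neg f x + neg g x))).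
  rewrite ge0_tsumB ?ge0_tsumD//; try exact: absumD.
  - rewrite (tsum_posneg fs) (tsum_posneg gs); ring.
  - by move=> x; rewrite addr_ge0.
  - by move=> x; rewrite addr_ge0.
by move=> x; rewrite {1}(posneg f) {1}(posneg g); ring.
Qed.

Lemma funepos_eq0 f x : f x = 0 -> (EFin \o f)^\+%E x = 0%E.
Proof. by rewrite funeposE /= => ->; rewrite maxxx. Qed.

Lemma funeneg_eq0 f x : f x = 0 -> (EFin \o f)^\-%E x = 0%E.
Proof. by rewrite funenegE /= => ->; rewrite oppr0 maxxx. Qed.

Lemma tsum_eq0 f : (forall x, f x = 0) -> tsum f = 0.
Proof.
move=> f0; rewrite /tsum !esum1 ?sube0// => x _; [exact: funeneg_eq0|exact: funepos_eq0].
Qed.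

Lemma tsumN {f} : absum f -> tsum (fun x => - f x) = - tsum f.
Proof.
move=> fs; have := tsumD fs (absumN fs).
by rewrite tsum_eq0 => [/esym/eqP|x]; rewrite ?subrr// addr_eq0 => /eqP ->; rewrite opprK.
Qed.

Lemma tsumB {f g} : absum f -> absum g ->
  tsum (fun x => f x - g x) = tsum f - tsum g.
Proof. by move=> fs gs; rewrite tsumD ?tsumN//; exact: absumN. Qed.

Lemma ge0_tsumZ (a : R) f : absum f -> 0 <= a -> (forall x, 0 <= f x) ->
  tsum (fun x => a * f x) = a * tsum f.
Proof.
move=> fs a0 f0; apply: EFin_inj; rewrite EFinM -!esum_tsum ?ge0_esumZ//.
- exact: absumZ.
- by move=> x; rewrite mulr_ge0.
Qed.

Lemma tsumZ (a : R) {f} : absum f -> tsum (fun x => a * f x) = a * tsum f.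
Proof.
wlog a0 : a / 0 <= a => [H|] fs.
  have [/H->//|/ltW an] := leP 0 a.
  rewrite (@eq_tsum _ (fun x => - (- a * f x))) => [|x]; last ring.
  by rewrite tsumN ?H ?oppr_ge0//; [ring|exact: absumZ].
rewrite (@eq_tsum _ (fun x => a * pos f x - a * neg f x)) => [|x]; last first.
  by rewrite {1}(posneg f); ring.
have [fp fn] := (absum_pos fs, absum_neg fs).
rewrite tsumB ?ge0_tsumZ//; try exact: absumZ.
by rewrite (tsum_posneg fs); ring.
Qed.

Lemma ler_tsum f g : absum f -> absum g -> (forall x, f x <= g x) ->
  tsum f <= tsum g.
Proof.
move=> fs gs fg; rewrite -subr_ge0 -tsumB//; apply: tsum_ge0; first exact: absumB.
by move=> x; rewrite subr_ge0.
Qed.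

Lemma esum_supp1 (h : T -> \bar R) x : (0 <= h x)%E ->
  (forall y, y != x -> h y = 0%E) -> (\esum_(y in [set: T]) h y = h x)%E.
Proof.
move=> h0 hx; rewrite -(@esum_set1 _ _ x)// [RHS]esum_mkcond.
apply: eq_esum => y _; case: ifPn => // /negP yx; apply: hx.
by apply/eqP => yxE; apply: yx; rewrite yxE; exact: mem_set.
Qed.

Lemma absum_supp1 {f x} : (forall y, y != x -> f y = 0) -> absum f.
Proof.
move=> fx; rewrite absumE (@esum_supp1 _ x) ?lee_fin ?ltry//.
by move=> y /fx ->; rewrite normr0.
Qed.

Lemma tsum_supp1 {f x} : (forall y, y != x -> f y = 0) -> tsum f = f x.
Proof.
move=> fx; rewrite /tsum !(@esum_supp1 _ x)//.
- by rewrite /= -[X in fine X]/(((EFin \o f)^\+ \- (EFin \o f)^\-)%E x) -funeposneg.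
- by move=> y /fx; exact: funeneg_eq0.
- by move=> y /fx; exact: funepos_eq0.
Qed.

Lemma ler_term_tsum f x : absum f -> (forall y, 0 <= f y) -> f x <= tsum f.
Proof.
move=> fs f0; pose g y := if y == x then f y else 0.
have gx y : y != x -> g y = 0 by rewrite /g => /negPf ->.
have -> : f x = tsum g by rewrite (tsum_supp1 gx) /g eqxx.
apply: ler_tsum => //; first exact: absum_supp1 gx.
by move=> y; rewrite /g; case: ifP.
Qed.

(** Fatou's lemma: each finite partial sum passes to the limit and stays below [K]. It transfers
    energy bounds to pointwise limits. *)
Lemma absum_fatou (h : nat -> T -> R) f (K : R) :
  (forall n, absum (h n)) -> (forall n x, 0 <= h n x) ->
  (forall x, h ^~ x @ \oo --> f x) -> (\forall n \near \oo, tsum (h n) <= K) ->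
  absum f /\ tsum f <= K.
Proof.
move=> hs h0 hf hK.
have f0 x : 0 <= f x.
  rewrite -(cvg_lim _ (hf x))//; apply: limr_ge; last exact: nearW.
  by apply/cvg_ex; exists (f x).
have fK : (\esum_(x in [set: T]) (f x)%:E <= K%:E)%E.
  apply: ge_ereal_sup => _ [F [finF _] <-].
  rewrite fsbig_finite//= sumEFin lee_fin.
  set r := finmap.enum_fset (fset_set F).
  have cv : \sum_(i <- r) h n i @[n --> \oo] --> \sum_(i <- r) f i.
    apply: (@cvg_big R T +%R 0 xpredT _ nat \oo r (fun i n => h n i) f).
    - exact: add_continuous.
    - by move=> i _; exact: hf.
  rewrite -(cvg_lim _ cv)//; apply: limr_le; first by apply/cvg_ex; eexists; exact: cv.
  near=> n; rewrite -lee_fin.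
  have : tsum (h n) <= K by near: n.
  rewrite -lee_fin; apply: le_trans; rewrite -esum_tsum//.
  by rewrite -sumEFin -fsbig_finite//; apply: ereal_sup_ubound; exists F.
have fs : absum f.
  rewrite absumE; under eq_esum do rewrite ger0_norm//.
  by apply: le_lt_trans fK _; rewrite ltry.
by split=> //; rewrite -lee_fin -esum_tsum.
Unshelve. all: by end_near. Qed.

End UnorderedSums.

(** * Sums along an injection *)

Section Reindexing.
Context {R : realType} {S T : countType} (e : S -> T).
Hypothesis e_inj : injective e.

Lemma esum_embed (h : T -> \bar R) : (forall t, 0 <= h t)%E ->
  (forall t, ~ range e t -> h t = 0%E) ->
  (\esum_(t in [set: T]) h t = \esum_(s in [set: S]) h (e s))%E.
Proof.
move=> h0 he; rewrite -(@reindex_esum _ _ _ setT (range e) e)//.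
  rewrite [RHS]esum_mkcond; apply: eq_esum => t _; case: ifPn => //.
  by rewrite notin_setE => /he.
by apply: inj_bij => // x y _ _; exact: e_inj.
Qed.

Lemma absum_embed (g : T -> R) : (forall t, ~ range e t -> g t = 0) ->
  absum (g \o e) -> absum g.
Proof.
by move=> ge; rewrite !absumE -(esum_embed (fun t => `|g t|%:E))// => t /ge ->; rewrite normr0.
Qed.

Lemma absum_comp (g : T -> R) : absum g -> absum (g \o e).
Proof.
move=> gs; pose h t := if t \in range e then g t else 0.
suff : absum h.
  rewrite !absumE (esum_embed (fun t => `|h t|%:E))// => [|t te].
    rewrite (@eq_esum _ _ _ _ (fun s => `|g (e s)|%:E))// => s _.
    by rewrite /h ifT// inE; exists s.
  by rewrite /h ifF ?normr0//; apply/negP => /set_mem.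
apply: absum_le (absum_norm gs) _ => t; rewrite /h.
by case: ifP => // _; rewrite normr0.
Qed.

Lemma tsum_embed (g : T -> R) : (forall t, ~ range e t -> g t = 0) ->
  tsum g = tsum (g \o e).
Proof.
move=> ge; rewrite /tsum !esum_embed//.
- by congr (fine (_ - _)); apply: eq_esum => s _; rewrite ?funeposE ?funenegE.
- by move=> y /ge; exact: funeneg_eq0.
- by move=> y /ge; exact: funepos_eq0.
Qed.

End Reindexing.

(** * Finitely supported functions *)

Lemma esum_sumT (R : realType) (S T : countType) (h : S + T -> \bar R) :
  (forall s, 0 <= h s)%E ->
  (\esum_(s in [set: S + T]) h s =
   \esum_(x in [set: S]) h (inl x) + \esum_(y in [set: T]) h (inr y))%E.
Proof.
move=> h0.
pose h1 s := if s is inl _ then h s else 0%E.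
pose h2 s := if s is inr _ then h s else 0%E.
have h1_ge0 s : (0 <= h1 s)%E by case: s => //= x; exact: h0.
have h2_ge0 s : (0 <= h2 s)%E by case: s => //= x; exact: h0.
rewrite (@eq_esum _ _ _ _ (fun s => h1 s + h2 s)%E) => [|[x|y] _]; last 2 first.
- by rewrite /= adde0.
- by rewrite /= add0e.
rewrite esumD//; congr (_ + _)%E.
- rewrite (@esum_embed _ _ _ inl) => //; first by move=> x y [].
  by case=> // x nx; exfalso; apply: nx; exists x.
- rewrite (@esum_embed _ _ _ inr) => //; first by move=> x y [].
  by case=> // x nx; exfalso; apply: nx; exists x.
Qed.

(** The discriminant argument, shared by the Cauchy-Schwarz inequality and the approximate
    Euler-Lagrange equation. *)
Lemma quadratic_nonneg_discr (R : realType) (p q r : R) :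
  (forall t, 0 <= p + 2 * t * q + t ^+ 2 * r) -> 0 <= r -> q ^+ 2 <= p * r.
Proof.
move=> H; rewrite le_eqVlt eq_sym => /orP[/eqP r0|r0].
  rewrite r0 mulr0; have [->|q0] := eqVneq q 0; first by rewrite expr0n.
  (* For [r = 0] the polynomial is affine; this [t] gives it the value [-1]. *)
  have := H (- (p + 1) / (2 * q)).
  rewrite r0 mulr0 addr0.
  have -> : 2 * (- (p + 1) / (2 * q)) * q = - (p + 1) by field.
  lra.
(* The vertex of the parabola. *)
have := H (- q / r).
have -> : p + 2 * (- q / r) * q + (- q / r) ^+ 2 * r = (p * r - q ^+ 2) / r
  by field; rewrite gt_eqF.
by rewrite pmulr_lge0 ?invr_gt0// subr_ge0.
Qed.

Section FiniteSupport.
Context {R : realType} {X : countType}.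
Implicit Types f g phi : X -> R.

Definition delta (x : X) : X -> R := fun y => (y == x)%:R.

Lemma finitely_supported0 : finitely_supported (fun _ : X => 0 : R).
Proof. by rewrite /finitely_supported (_ : [set _ | _] = set0)// -subset0 => x /=; rewrite eqxx. Qed.

Lemma finitely_supported_sub {f g} : finitely_supported f ->
  (forall x, f x = 0 -> g x = 0) -> finitely_supported g.
Proof.
move=> ff fg; apply: sub_finite_set ff => x /=.
by apply: contra_neq => /fg.
Qed.

Lemma finitely_supportedD {f g} : finitely_supported f -> finitely_supported g ->
  finitely_supported (fun x => f x + g x).
Proof.
move=> ff fg; apply: (@sub_finite_set _ _ ([set x | f x != 0] `|` [set x | g x != 0])).
  move=> x /= fgx; have [f0|] := eqVneq (f x) 0; last by left.
  by right; move: fgx; rewrite f0 add0r.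
by rewrite finite_setU.
Qed.

Lemma finitely_supportedZ a {f} : finitely_supported f ->
  finitely_supported (fun x => a * f x).
Proof. by move=> ff; apply: finitely_supported_sub ff _ => x ->; rewrite mulr0. Qed.

Lemma finitely_supported_delta x : finitely_supported (delta x).
Proof.
apply: sub_finite_set (finite_set1 x) => y /=.
by rewrite /delta; have [->|] := eqVneq y x; rewrite ?eqxx.
Qed.

(** Peels off one vertex at a time from a list containing the support. It reduces Green's formula to
    the functions [delta x]. *)
Lemma finitely_supported_ind (P : (X -> R) -> Prop) :
  P (fun=> 0) ->
  (forall f a x, finitely_supported f -> P f -> P (fun y => f y + a * delta x y)) ->
  forall f, finitely_supported f -> P f.
Proof.
move=> P0 PD f /finite_seqP[s fs].
have {fs} : forall x, x \notin s -> f x = 0.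
  move=> x; apply: contraNeq => fx; have : [set x | f x != 0] x by [].
  by rewrite fs.
elim: s f => [|x s IH] f fs.
  by rewrite (_ : f = fun=> 0)//; apply/funext => x; exact: fs.
pose g y := f y + - f x * delta x y.
have gs y : y \notin s -> g y = 0.
  rewrite /g /delta => ys; case: eqVneq => [->|yx]; first by rewrite mulr1 subrr.
  by rewrite mulr0 addr0 fs// inE negb_or yx.
rewrite (_ : f = fun y => g y + f x * delta x y).
  apply: PD; last exact: IH.
  apply/finite_seqP; exists (seq.filter (fun y => g y != 0) s).
  apply/seteqP; split => y /=; rewrite mem_filter.
    by move=> gy; rewrite gy/=; apply: contraNT gy => /gs ->.
  by case/andP.
by apply/funext => y; rewrite /g; ring.
Qed.

Lemma finitely_supported_absum {f} : finitely_supported f -> absum f.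
Proof.
elim/finitely_supported_ind: f / => [|f a x _ fs].
  by rewrite absumE esum1 ?ltry// => x _; rewrite normr0.
apply: absumD => //; apply: (@absum_supp1 _ _ _ x) => y /negPf yx.
by rewrite /delta yx mulr0.
Qed.

Lemma finitely_supported_bounded {f} : finitely_supported f ->
  exists M, forall x, `|f x| <= M.
Proof.
elim/finitely_supported_ind: f / => [|f a x _ [M fM]].
  by exists 0 => x; rewrite normr0.
exists (M + `|a|) => y; apply: le_trans (ler_normD _ _) _; apply: lerD => //.
rewrite normrM ler_piMr// /delta; case: eqP => _; rewrite ?normr1 ?normr0//.
Qed.

End FiniteSupport.

Set Implicit Arguments.

(** * Energy form and Green's formula *)

Section EnergyForm.
Context {R : realType} {X : countType}.
Variables (b : X -> X -> R) (c : X -> R).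
Hypothesis graph_bc : is_graph b c.
Implicit Types f g phi : X -> R.

(* The killing term is handled as edges to a cemetery where functions vanish: the
   energy is one weighted sum of squares of a linear map, over ordered pairs
   (hence the factor 1/2) and vertices. *)
Definition grad f (s : (X * X) + X) : R :=
  match s with inl p => f p.1 - f p.2 | inr x => f x end.

Definition weight (s : (X * X) + X) : R :=
  match s with inl p => b p.1 p.2 / 2 | inr x => c x end.

Definition dens f g s : R := weight s * (grad f s * grad g s).

(** The polarization of the energy: [dform f f] is $\mathcal{Q}(f)$ when [dens f f] is summable. *)
Definition dform f g : R := tsum (dens f g).

Let b_sym x y : b x y = b y x. Proof. by case: graph_bc. Qed.
Let b_ge0 x y : 0 <= b x y. Proof. by case: graph_bc. Qed.
Let c_ge0 x : 0 <= c x. Proof. by case: graph_bc. Qed.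

Lemma weight_ge0 s : 0 <= weight s.
Proof. by case: s => [p|x] /=; rewrite ?divr_ge0. Qed.

Lemma densC f g s : dens f g s = dens g f s.
Proof. by rewrite /dens (mulrC (grad f s)). Qed.

Lemma dens_ge0 f s : 0 <= dens f f s.
Proof. by rewrite mulr_ge0 ?weight_ge0// -expr2 sqr_ge0. Qed.

Lemma densDr f g h a s :
  dens f (fun x => g x + a * h x) s = dens f g s + a * dens f h s.
Proof. by rewrite /dens /grad; case: s => [p|x]; ring. Qed.

Lemma densDl f g h a s :
  dens (fun x => g x + a * h x) f s = dens g f s + a * dens h f s.
Proof. by rewrite densC densDr !(densC f). Qed.

Lemma absum_densDr {f g h} a : absum (dens f g) -> absum (dens f h) ->
  absum (dens f (fun x => g x + a * h x)).
Proof.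
move=> fg fh; rewrite (_ : dens f _ = fun s => dens f g s + a * dens f h s).
  by apply: absumD fg _; exact: absumZ.
by apply/funext => s; rewrite densDr.
Qed.

Lemma dformDr f g h a : absum (dens f g) -> absum (dens f h) ->
  dform f (fun x => g x + a * h x) = dform f g + a * dform f h.
Proof.
move=> fg fh; rewrite /dform (funext (densDr f g h a)) tsumD//.
  by rewrite tsumZ.
exact: absumZ.
Qed.

Lemma dformC f g : dform f g = dform g f.
Proof. by apply: eq_tsum => s; rewrite densC. Qed.

Lemma absum_densC {f g} : absum (dens f g) -> absum (dens g f).
Proof. by rewrite (_ : dens f g = dens g f)//; apply/funext => s; exact: densC. Qed.

Lemma dform_ge0 f : absum (dens f f) -> 0 <= dform f f.
Proof. by move=> ff; apply: tsum_ge0 => // s; exact: dens_ge0. Qed.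

Lemma energy_esum f : energy b c f = (\esum_(s in setT) (dens f f s)%:E)%E.
Proof.
rewrite /energy esum_sumT => [|s]; last by rewrite lee_fin dens_ge0.
rewrite -ge0_esumZ ?invr_ge0// => [|p]; last by rewrite mulr_ge0 ?sqr_ge0.
by congr (_ + _)%E; apply: eq_esum => s _; rewrite /dens/= expr2// mulrCA mulrA.
Qed.

Lemma finite_energyE f : finite_energy b c f <-> absum (dens f f).
Proof.
rewrite /finite_energy energy_esum absumE.
by under [X in _ <-> (X < _)%E]eq_esum do rewrite ger0_norm ?dens_ge0//.
Qed.

Lemma energy_dform f : absum (dens f f) -> energy b c f = (dform f f)%:E.
Proof. by move=> ff; rewrite energy_esum esum_tsum// => s; exact: dens_ge0. Qed.

(** Termwise domination by $|uv| \le u^2 + v^2$. *)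
Lemma absum_dens {f g} : absum (dens f f) -> absum (dens g g) -> absum (dens f g).
Proof.
move=> ff gg; apply: absum_le (absumD ff gg) _ => s.
rewrite /dens normrM ger0_norm ?weight_ge0// -mulrDr ler_wpM2l ?weight_ge0//.
set u := grad f s; set v := grad g s.
rewrite normrM -!expr2 -(real_normK (num_real u)) -(real_normK (num_real v)).
by have := sqr_ge0 (`|u| - `|v|); have := normr_ge0 u; have := normr_ge0 v; nra.
Qed.

Lemma dens_sqrD f g a s : dens (fun x => f x + a * g x) (fun x => f x + a * g x) s =
  dens f f s + (2 * a * dens f g s + a ^+ 2 * dens g g s).
Proof. by rewrite densDl !densDr (densC g); ring. Qed.

Lemma finite_energyD {f g} a : absum (dens f f) -> absum (dens g g) ->
  absum (dens (fun x => f x + a * g x) (fun x => f x + a * g x)).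
Proof.
move=> ff gg; have fg := absum_dens ff gg.
rewrite (funext (dens_sqrD f g a)).
by apply: absumD ff _; apply: absumD; exact: absumZ.
Qed.

Lemma dform_sqrD f g a : absum (dens f f) -> absum (dens g g) ->
  dform (fun x => f x + a * g x) (fun x => f x + a * g x) =
  dform f f + 2 * a * dform f g + a ^+ 2 * dform g g.
Proof.
move=> ff gg; have fg := absum_dens ff gg.
have [s1 s2] := (absumZ (2 * a) fg, absumZ (a ^+ 2) gg).
by rewrite /dform (funext (dens_sqrD f g a)) (tsumD ff (absumD s1 s2)) (tsumD s1 s2) !tsumZ// addrA.
Qed.

Lemma dform_cauchy_schwarz {f g} : absum (dens f f) -> absum (dens g g) ->
  dform f g ^+ 2 <= dform f f * dform g g.
Proof.
move=> ff gg; apply: quadratic_nonneg_discr; last exact: dform_ge0.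
by move=> t; rewrite -dform_sqrD// dform_ge0//; exact: finite_energyD.
Qed.

Lemma absum_weight x : absum (b x).
Proof.
case: graph_bc => _ _ _ /(_ x) bx _; rewrite absumE.
by under eq_esum do rewrite ger0_norm//.
Qed.

Lemma bounded_laplacian_domain f M : (forall x, `|f x| <= M) -> laplacian_domain b f.
Proof.
move=> fM x; apply: absum_le (absumZ M (absum_weight x)) _ => y.
by rewrite normrM normr_id mulrC ger0_norm// ler_wpM2r.
Qed.

(** The inclusion $\mathcal{D}\subseteq\mathcal{F}$: $|f(y)| \le |f(x)| + |f(x)-f(y)|$ and $|t| \le
    1 + t^2$, so the sum at [x] is dominated by the weights at [x] and the energy of the edges
    leaving [x]. The factor 2 cancels the 1/2 in [weight]. *)
Lemma finite_energy_laplacian_domain f : absum (dens f f) -> laplacian_domain b f.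
Proof.
move=> ff x.
have e_inj : injective (fun y : X => inl X (x, y)) by move=> y z [].
have := absumD (absumZ (`|f x| + 1) (absum_weight x))
               (absumZ 2 (absum_comp _ e_inj _ ff)).
move=> /absum_le; apply => y; rewrite /= /dens/=.
rewrite normrM normr_id (ger0_norm (b_ge0 x y)).
rewrite [leRHS](_ : _ = b x y * (`|f x| + 1 + (f x - f y) ^+ 2)); last by field.
apply: ler_wpM2l => //.
have : `|f y| <= `|f x| + `|f x - f y|.
  by rewrite -[f y in leLHS](subKr (f x)) ler_normB.
rewrite -(real_normK (num_real (f x - f y))).
have := sqr_ge0 (`|f x - f y| - 1); have := normr_ge0 (f x - f y); nra.
Qed.

Lemma absum_laplacian {f} : laplacian_domain b f ->
  forall x, absum (fun y => b x y * (f x - f y)).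
Proof.
move=> fd x.
have := absumD (absumZ `|f x| (absum_weight x)) (fd x).
move=> /absum_le; apply => y; rewrite normrM ger0_norm//=.
rewrite [leRHS](_ : _ = b x y * (`|f x| + `|f y|)); last by ring.
by rewrite ler_wpM2l// ler_normB.
Qed.

(** Only the edges at [x] and the vertex [x] contribute, so membership of [f] in $\mathcal{F}$
    suffices and its energy may be infinite. *)
Lemma green_delta f x : laplacian_domain b f ->
  absum (dens f (delta x)) /\ dform f (delta x) = laplacian b c f x.
Proof.
move=> fd; have fx := absum_laplacian fd x.
have hfx := absumZ 2^-1 fx.
(* [A] carries the edges leaving [x], [B] those arriving at [x], and [C] the killing term. By
   symmetry of [b], [A] and [-B] each sum to half of the edge part of the Laplacian. *)
pose A (s : (X * X) + X) : R :=
  if s is inl p then if p.1 == x then weight s * grad f s else 0 else 0.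
pose B (s : (X * X) + X) : R :=
  if s is inl p then if p.2 == x then weight s * grad f s else 0 else 0.
pose C (s : (X * X) + X) : R :=
  if s is inr y then if y == x then c y * f y else 0 else 0.
have i1 : injective (fun y : X => inl X (x, y)) by move=> y z [].
have i2 : injective (fun y : X => inl X (y, x)) by move=> y z [].
have rA s : ~ range (fun y : X => inl X (x, y)) s -> A s = 0.
  case: s => // -[y z] /= n; case: eqP => // yx; exfalso; apply: n.
  by exists z => //; rewrite yx.
have rB s : ~ range (fun y : X => inl X (y, x)) s -> B s = 0.
  case: s => // -[y z] /= n; case: eqP => // yx; exfalso; apply: n.
  by exists y => //; rewrite yx.
have rC s : s != inr x -> C s = 0.
  by case: s => //= y; have [->|//] := eqVneq y x; rewrite eqxx.
have eA : A \o (fun y : X => inl X (x, y)) = (fun y => 2^-1 * (b x y * (f x - f y))).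
  by apply/funext => y; rewrite /= eqxx; ring.
have eB : B \o (fun y : X => inl X (y, x)) = (fun y => - (2^-1 * (b x y * (f x - f y)))).
  by apply/funext => y; rewrite /= eqxx b_sym; ring.
have sA : absum A by apply: (absum_embed _ i1) => //; rewrite eA.
have sB : absum B by apply: (absum_embed _ i2) => //; rewrite eB; exact: absumN.
have sC : absum C by exact: absum_supp1 rC.
have dE s : dens f (delta x) s = A s - B s + C s.
  case: s => [[y z]|y]; rewrite /dens /delta /=; do ?case: eqP => _ /=; ring.
have dE' : dens f (delta x) = (fun s => A s - B s + C s) by exact/funext.
split; first by rewrite dE'; apply: absumD => //; exact: absumB.
rewrite /dform dE' tsumD ?tsumB//; last exact: absumB.
rewrite (tsum_embed _ i1)// (tsum_embed _ i2)// eA eB tsumN// tsumZ//.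
rewrite (tsum_supp1 rC) /C eqxx /laplacian; by field.
Qed.

Lemma green f phi : laplacian_domain b f -> finitely_supported phi ->
  absum (dens f phi) /\ dform f phi = tsum (fun x => phi x * laplacian b c f x).
Proof.
move=> fd; elim/(@finitely_supported_ind R X): phi / => [|phi a x fphi [IH1 IH2]].
  have d0 s : dens f (fun=> 0) s = 0.
    by case: s => [p|x]; rewrite /dens/= ?subrr !mulr0.
  split; last by rewrite /dform !tsum_eq0// => x; rewrite mul0r.
  by rewrite absumE esum1 ?ltry// => s _; rewrite d0 normr0.
have [dx1 dx2] := green_delta x fd.
split; first exact: absum_densDr.
rewrite dformDr// IH2 dx2.
rewrite [in RHS](_ : (fun y => _) = fun y => phi y * laplacian b c f y +
    a * (delta x y * laplacian b c f y)); last by apply/funext => y; ring.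
have s1 y : y != x -> delta x y * laplacian b c f y = 0.
  by rewrite /delta => /negPf ->; rewrite mul0r.
have s2 : absum (fun y => phi y * laplacian b c f y).
  apply: finitely_supported_absum; apply: finitely_supported_sub fphi _ => y ->.
  by rewrite mul0r.
rewrite tsumD//; last by apply: absumZ; exact: absum_supp1 s1.
rewrite tsumZ; last exact: absum_supp1 s1.
by rewrite (tsum_supp1 s1) /delta eqxx mul1r.
Qed.

Lemma finitely_supported_laplacian_domain phi :
  finitely_supported phi -> laplacian_domain b phi.
Proof. by move=> /finitely_supported_bounded[M]; exact: bounded_laplacian_domain. Qed.

Lemma finitely_supported_energy phi :
  finitely_supported phi -> absum (dens phi phi).
Proof.
by move=> fphi; have [] := green (finitely_supported_laplacian_domain fphi) fphi.
Qed.

End EnergyForm.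

(** * Minimizing the energy *)

Lemma cvg_sqr_cauchy (R : realType) (u : nat -> R) (K : R) :
  (forall n k, (u n - u k) ^+ 2 <= K * (n.+1%:R^-1 + k.+1%:R^-1)) ->
  exists l : R, u @ \oo --> l.
Proof.
move=> uK; suff : cvgn u by move=> /cvg_ex.
(* A non-positive [K] forces the sequence to be constant. *)
have [N0|K0] := leP K 0.
  have uc n : u n = u 0%N.
    apply/eqP; rewrite -subr_eq0 -sqrf_eq0 eq_le sqr_ge0 andbT.
    by apply: le_trans (uK _ _) _; rewrite mulr_le0_ge0// addr_ge0.
  by apply/cvg_ex; exists (u 0%N); rewrite (funext uc); exact: cvg_cst.
apply/cauchy_cvgP/cauchy_exP => e e0.
(* Chosen so that [K * 2 / N.+1 < e ^ 2]. *)
pose N := Num.truncn (K * 2 / e ^+ 2).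
exists (u N); exists N => // n /= Nn.
rewrite /ball /= -(ltr_pXn2r (n := 2))// ?nnegrE ?ltW//.
rewrite real_normK ?num_real//; apply: le_lt_trans (uK _ _) _.
have Ne : K * 2 / e ^+ 2 < N.+1%:R by rewrite truncnS_gt.
have nN : n.+1%:R^-1 <= N.+1%:R^-1 :> R by rewrite lef_pV2 ?posrE ?ltr0n// ler_nat.
apply: (@le_lt_trans _ _ (K * 2 * N.+1%:R^-1)).
  by rewrite -mulrA ler_pM2l// mulr2n mulrDl mul1r lerD2l.
by rewrite ltr_pdivrMr ?ltr0n// -ltr_pdivrMl ?exprn_gt0// mulrC.
Qed.

Lemma sqr_eq0_small (R : realType) (x K : R) :
  (forall n, x ^+ 2 <= K * n.+1%:R^-1) -> x = 0.
Proof.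
move=> xK; apply/eqP; rewrite -sqrf_eq0 eq_le sqr_ge0 andbT leNgt.
apply/negP => x0.
have := xK (Num.truncn (K / x ^+ 2)); apply/negP; rewrite -ltNge.
by rewrite ltr_pdivrMr ?ltr0n// -ltr_pdivrMl// mulrC truncnS_gt.
Qed.

Section Minimizer.
Context {R : realType} {X : countType}.
Variables (b : X -> X -> R) (c : X -> R).
Hypothesis graph_bc : is_graph b c.
Implicit Types f g phi psi : X -> R.

Variable ell : (X -> R) -> R.
Hypothesis ellD : forall phi psi a, finitely_supported phi ->
  finitely_supported psi ->
  ell (fun x => phi x + a * psi x) = ell phi + a * ell psi.

Let J phi := dform b c phi phi - 2 * ell phi.

Hypothesis point_bound : forall x, exists C, forall phi,
  finitely_supported phi -> phi x ^+ 2 <= C * dform b c phi phi.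

(** Kept apart from the passage to the limit, so that a minimizing sequence can be modified, for
    instance truncated, before its limit is taken. The rate [1 / (n + 1)] makes the later estimates
    explicit. *)
Lemma minimizing_sequence m0 :
  (forall phi, finitely_supported phi -> m0 <= J phi) ->
  exists m (phi_ : nat -> X -> R),
    (forall phi, finitely_supported phi -> m <= J phi) /\
    (forall n, finitely_supported (phi_ n) /\ J (phi_ n) <= m + n.+1%:R^-1).
Proof.
move=> Jm0; pose V := [set J phi | phi in @finitely_supported R X].
have Vinf : has_inf V.
  split; first by exists (J (fun=> 0)), (fun=> 0) => //; exact: finitely_supported0.
  by exists m0 => _ [phi fphi <-]; exact: Jm0.
have /choice[phi_ phiP] : forall n : nat, exists phi, finitely_supported phi /\
    J phi <= inf V + n.+1%:R^-1.
  move=> n; have n0 : 0 < n.+1%:R^-1 :> R by rewrite invr_gt0 ltr0n.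
  have [_ [phi fphi <-] /ltW phiV] := inf_adherent n0 Vinf.
  by exists phi.
exists (inf V), phi_; split => // phi fphi.
by apply: ge_inf; [exact: Vinf.2|exists phi].
Qed.

Variables (m : R) (phi_ : nat -> X -> R).
Hypothesis Jm : forall phi, finitely_supported phi -> m <= J phi.
Hypothesis phiP : forall n,
  finitely_supported (phi_ n) /\ J (phi_ n) <= m + n.+1%:R^-1.

Let eps n : R := n.+1%:R^-1.

Let fphi n : finitely_supported (phi_ n). Proof. by have [] := phiP n. Qed.

Let JD phi psi a : finitely_supported phi -> finitely_supported psi ->
  J (fun x => phi x + a * psi x) =
  J phi + 2 * a * (dform b c phi psi - ell psi) + a ^+ 2 * dform b c psi psi.
Proof.
move=> fp fq; rewrite /J dform_sqrD ?ellD//; first ring.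
- exact: finitely_supported_energy.
- exact: finitely_supported_energy.
Qed.

(* Comparing J at the two functions with its value at their midpoint. *)
Lemma minimizing_sequence_cauchy n k :
  dform b c (fun x => phi_ n x + -1 * phi_ k x) (fun x => phi_ n x + -1 * phi_ k x)
    <= 2 * (eps n + eps k).
Proof.
have [en ek] := (finitely_supported_energy graph_bc (fphi n), finitely_supported_energy graph_bc (fphi k)).
have := Jm (finitely_supportedD (finitely_supportedZ 2^-1 (fphi n))
  (finitely_supportedZ 2^-1 (fphi k))).
have [_] := phiP n; have [_] := phiP k.
have fd : finitely_supported (fun x => phi_ k x + -1 * phi_ n x).
  exact: finitely_supportedD (fphi k) (finitely_supportedZ _ (fphi n)).
rewrite (_ : (fun x => 2^-1 * _ + _) = fun x => phi_ n x + 2^-1 * (phi_ k x + -1 * phi_ n x));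
  last by apply/funext => x; field.
rewrite JD// /J !dform_sqrD// ellD// dformDr//; last exact: absum_dens.
rewrite (dformC b c (phi_ k) (phi_ n)) -/(eps n) -/(eps k) => H1 H2 H3.
lra.
Qed.

(** [J (phi_ n + t * psi)] is at least [m], hence at least [J (phi_ n) - eps n], for every [t]; the
    discriminant of this quadratic in [t] gives the bound. *)
Lemma euler_lagrange_approx n psi : finitely_supported psi ->
  (dform b c (phi_ n) psi - ell psi) ^+ 2 <= eps n * dform b c psi psi.
Proof.
move=> fpsi; apply: quadratic_nonneg_discr.
  move=> t; have := Jm (finitely_supportedD (fphi n) (finitely_supportedZ t fpsi)).
  have [_] := phiP n; rewrite JD// -/(eps n) => H1 H2; lra.
by apply: dform_ge0 => //; exact: finitely_supported_energy.
Qed.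

Lemma minimizer : exists g, [/\ forall x, phi_ ^~ x @ \oo --> g x,
  forall n, let h := fun x => g x + -1 * phi_ n x in
    absum (dens b c h h) /\ dform b c h h <= 4 * eps n,
  absum (dens b c g g) &
  forall x, laplacian b c g x = ell (delta x)].
Proof.
(* The capacity inequality turns the Cauchy property in energy into one at each vertex. *)
have /choice[g gP] : forall x, exists l : R, phi_ ^~ x @ \oo --> l.
  move=> x; have [C CP] := point_bound x.
  have C0 : 0 <= `|C| by [].
  apply: (@cvg_sqr_cauchy _ _ (`|C| * 2)) => n k.
  have fd : finitely_supported (fun x => phi_ n x + -1 * phi_ k x).
    exact: finitely_supportedD (fphi n) (finitely_supportedZ _ (fphi k)).
  have := CP _ fd; have := minimizing_sequence_cauchy n k.
  have := dform_ge0 graph_bc (finitely_supported_energy graph_bc fd).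
  set D := dform _ _ _ _ => D0 D1 D2.
  rewrite mulN1r in D2; apply: le_trans D2 _.
  by rewrite -mulrA; apply: le_trans (ler_wpM2r D0 (ler_norm C)) _; rewrite ler_wpM2l.
have hP n : let h := fun x => g x + -1 * phi_ n x in
    absum (dens b c h h) /\ dform b c h h <= 4 * eps n.
  (* Fatou's lemma as [k] grows with [n] fixed: for [k >= n] the Cauchy bound [2 * (eps k + eps n)]
     is at most [4 * eps n]. *)
  pose d k := fun x => phi_ k x + -1 * phi_ n x.
  apply: (@absum_fatou _ _ (fun k => dens b c (d k) (d k))).
  - move=> k; apply: finitely_supported_energy => //.
    exact: finitely_supportedD (fphi k) (finitely_supportedZ _ (fphi n)).
  - by move=> k s; exact: dens_ge0.
  - have dg x : d ^~ x @ \oo --> g x + -1 * phi_ n x.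
      by apply: cvgD => //; exact: cvg_cst.
    move=> s; rewrite /dens; apply: cvgM; first exact: cvg_cst.
    have gs : grad (d k) s @[k --> \oo] --> grad (fun x => g x + -1 * phi_ n x) s.
      case: s => [p|x] /=; last exact: dg.
      by apply: cvgB; exact: dg.
    exact: cvgM.
  - exists n => // k /= nk; apply: le_trans (minimizing_sequence_cauchy k n) _.
    have : eps k <= eps n by rewrite lef_pV2 ?posrE ?ltr0n// ler_nat.
    lra.
have gg : absum (dens b c g g).
  have [h0 _] := hP 0%N.
  have := finite_energyD graph_bc 1 h0 (finitely_supported_energy graph_bc (fphi 0%N)).
  rewrite (_ : (fun x => _ + 1 * _) = g)//.
  by apply/funext => x; ring.
exists g; split => // x.
have fdx := @finitely_supported_delta R X x.
have edx := finitely_supported_energy graph_bc fdx.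
have [_ gx] := green_delta graph_bc x (finite_energy_laplacian_domain graph_bc gg).
apply/eqP; rewrite -subr_eq0; apply/eqP.
(* With [P] the form of [phi_ n] and [delta x], the square of [L - P] is at most [4 * eps n * D] and
   that of [P - ell (delta x)] at most [eps n * D]; then $(a+b)^2 \le 2a^2+2b^2$ yields 10. *)
apply: (@sqr_eq0_small _ _ (10 * dform b c (delta x) (delta x))) => n.
have [hn hle] := hP n.
have fn := finitely_supported_energy graph_bc (fphi n).
have := dform_cauchy_schwarz graph_bc hn edx.
have -> : dform b c (fun x => g x + -1 * phi_ n x) (delta x) =
    laplacian b c g x + -1 * dform b c (phi_ n) (delta x).
  rewrite dformC dformDr; try exact: absum_dens.
  by rewrite dformC gx (dformC b c (delta x)).
have := euler_lagrange_approx n fdx.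
have ed0 := dform_ge0 graph_bc edx.
have := ler_wpM2r ed0 hle.
rewrite -/(eps n).
set L := laplacian _ _ _ _; set P := dform b c (phi_ n) _.
set D := dform b c (delta x) _; set E := dform _ _ _ _ => H1 H2 H3.
have := sqr_ge0 (L + -1 * P - (P - ell (delta x))).
nra.
Qed.

End Minimizer.

(** * Transience and the capacity inequality *)

Section Transience.
Context {R : realType} {X : countType}.
Variables (b : X -> X -> R) (c : X -> R).
Hypothesis graph_bc : is_graph b c.
Implicit Types f g h phi psi : X -> R.

Let b_ge0 x y : 0 <= b x y. Proof. by case: graph_bc. Qed.
Let c_ge0 x : 0 <= c x. Proof. by case: graph_bc. Qed.

Lemma is_graph_no_killing : is_graph b (cst 0).
Proof. by case: graph_bc => *; split. Qed.

Lemma connected_const f : connected_graph b ->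
  (forall x y, 0 < b x y -> f x = f y) -> forall x y, f x = f y.
Proof.
move=> conn fb x y; have [p] := conn x y.
elim: p x => [|z p IH] x /= => [_ ->//|/andP[bxz pz] lastp].
by rewrite (fb _ _ bxz) (IH z).
Qed.

Lemma edge_le_dform f x y : absum (dens b c f f) ->
  b x y / 2 * (f x - f y) ^+ 2 <= dform b c f f.
Proof.
move=> ff; have := ler_term_tsum _ (inl (x, y)) ff (dens_ge0 graph_bc f).
by rewrite /dens /= -expr2.
Qed.

(** Positive capacity of [x]: the energy is bounded away from 0 on finitely supported functions with
    value 1 at [x]. *)
Definition point_bounded x := exists C, forall phi,
  finitely_supported phi -> phi x ^+ 2 <= C * dform b c phi phi.

(** Across an edge from [x] to [z], $\varphi(z)^2 \le 2\varphi(x)^2 + 2(\varphi(x)-\varphi(z))^2$,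
    and the last square is at most [2 / b x z] times the energy. *)
Lemma point_bounded_connected x : connected_graph b -> point_bounded x ->
  forall y, point_bounded y.
Proof.
move=> conn xC y; have [p] := conn x y.
elim: p x xC => [|z p IH] x xC /= => [_ <-//|/andP[bxz pz] lastp].
apply: (IH z) => //; have [C CP] := xC.
exists (2 * C + 4 / b x z) => phi fphi.
have := edge_le_dform x z (finitely_supported_energy graph_bc fphi).
have := CP _ fphi; set D := dform _ _ _ _ => H1 H2.
have {}H2 : (phi x - phi z) ^+ 2 <= 2 / b x z * D.
  rewrite -ler_pdivrMl ?divr_gt0// invf_div; exact: H2.
have := sqr_ge0 (phi x + (phi x - phi z)).
rewrite mulrDl (_ : 4 / b x z = 2 * (2 / b x z)); last by ring.
set E := 2 / b x z in H2 *; nra.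
Qed.

Lemma norm_at_lt o f e : absum (dens b c f f) -> 0 < e ->
  (norm_at b c o f < e%:E)%E = (dform b c f f + f o ^+ 2 < e ^+ 2).
Proof.
move=> ff e0; rewrite /norm_at energy_dform// -EFinD/= lte_fin real_normK ?num_real//.
have eE : e = Num.sqrt (e ^+ 2) by rewrite sqrtr_sqr gtr0_norm.
by rewrite {1}eE ltr_sqrt// exprn_gt0.
Qed.

(** Removes the square root from the norm and writes differences as [f x + -1 * phi x], the shape
    expected by the bilinearity rules. *)
Lemma finite_energy0P o f : finite_energy0 b c o f <->
  absum (dens b c f f) /\ forall e, 0 < e -> exists2 phi, finitely_supported phi &
    let h := fun x => f x + -1 * phi x in dform b c h h + h o ^+ 2 < e.
Proof.
have subE phi : (fun x => f x - phi x) = (fun x => f x + -1 * phi x).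
  by apply/funext => x; rewrite mulN1r.
rewrite /finite_energy0 (finite_energyE graph_bc).
split=> -[ff fe]; split=> //.
  move=> e e0; have [|phi fphi] := fe (Num.sqrt e); first by rewrite sqrtr_gt0.
  rewrite subE norm_at_lt ?sqrtr_gt0// ?sqr_sqrtr ?ltW//; first by exists phi.
  by apply: (finite_energyD graph_bc) => //; exact: finitely_supported_energy.
move=> e e0; have [|phi fphi H] := fe (e ^+ 2); first by rewrite exprn_gt0.
exists phi => //; rewrite subE norm_at_lt//.
by apply: (finite_energyD graph_bc) => //; exact: finitely_supported_energy.
Qed.

Lemma dform_sub_le f g : absum (dens b c f f) -> absum (dens b c g g) ->
  dform b c (fun x => f x + -1 * g x) (fun x => f x + -1 * g x) <=
  2 * dform b c f f + 2 * dform b c g g.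
Proof.
move=> ff gg; have := dform_ge0 graph_bc (finite_energyD graph_bc 1 ff gg).
by rewrite !(dform_sqrD graph_bc)//; lra.
Qed.

Lemma finite_energy0_sub o f g : finite_energy0 b c o f -> finite_energy0 b c o g ->
  finite_energy0 b c o (fun x => f x + -1 * g x).
Proof.
move=> /finite_energy0P[ff fe] /finite_energy0P[gg ge]; apply/finite_energy0P.
split; first exact: finite_energyD.
move=> e e0; have e40 : 0 < e / 4 by rewrite divr_gt0.
have [phi fphi] := fe _ e40; have [psi fpsi] := ge _ e40.
move=> /= Hpsi Hphi; exists (fun x => phi x + -1 * psi x).
  exact: finitely_supportedD fphi (finitely_supportedZ _ fpsi).
have h1 := finite_energyD graph_bc (-1) ff (finitely_supported_energy graph_bc fphi).
have h2 := finite_energyD graph_bc (-1) gg (finitely_supported_energy graph_bc fpsi).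
have := dform_sub_le h1 h2.
rewrite (_ : (fun x => f x + -1 * phi x + _) = fun x => f x + -1 * g x + -1 * (phi x + -1 * psi x));
  last by apply/funext => x; ring.
have := sqr_ge0 (f o + -1 * phi o + (g o + -1 * psi o)).
move=> /=; nra.
Qed.

(** By Green's formula [f] is orthogonal to all finitely supported functions, yet it is a limit of
    such functions; hence its energy is 0 and it is constant. The capacity inequality at [o] makes
    the constant 0. *)
Lemma finite_energy0_harmonic_eq0 o f : connected_graph b -> point_bounded o ->
  finite_energy0 b c o f -> (forall x, laplacian b c f x = 0) -> forall x, f x = 0.
Proof.
move=> conn [C CP] /finite_energy0P[ff fe] Lf.
have fd := finite_energy_laplacian_domain graph_bc ff.
have orth phi : finitely_supported phi -> dform b c f phi = 0.
  by move=> fphi; rewrite (green graph_bc fd fphi).2 tsum_eq0// => x; rewrite Lf mulr0.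
(* By orthogonality the energy of [f - phi] is the sum of both energies. The second bound comes from
   $f(o)^2 \le 2(f(o)-\varphi(o))^2 + 2\varphi(o)^2$, with the capacity inequality applied to
   [phi]. *)
have key e : 0 < e -> dform b c f f < e /\ f o ^+ 2 < 2 * (1 + `|C|) * e.
  move=> e0; have [phi fphi] := fe _ e0.
  have ephi := finitely_supported_energy graph_bc fphi.
  rewrite /= (dform_sqrD graph_bc)// (orth _ fphi) => H.
  have := CP _ fphi; have := ler_norm C; have := normr_ge0 C.
  have := dform_ge0 graph_bc ff; have := dform_ge0 graph_bc ephi.
  move: H; set D := dform _ _ f f; set E := dform _ _ phi phi.
  set K := `|C| => H E0 D0 K0 CK H1.
  have H2 : phi o ^+ 2 <= K * E by apply: le_trans H1 _; rewrite ler_wpM2r.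
  have H3 : K * E <= K * e.
    by rewrite ler_wpM2l//; have := sqr_ge0 (f o + -1 * phi o); lra.
  have := sqr_ge0 (f o + -1 * phi o).
  by have := sqr_ge0 (f o + -2 * phi o); split; nra.
have ff0 : dform b c f f <= 0.
  by rewrite leNgt; apply/negP => /key[]; rewrite ltxx.
have fo : f o = 0.
  apply/eqP; rewrite -sqrf_eq0 eq_le sqr_ge0 andbT leNgt; apply/negP => fo.
  have K0 : 0 < 2 * (1 + `|C|) by have := normr_ge0 C; lra.
  have [_] := key (f o ^+ 2 / (2 * (1 + `|C|))) (divr_gt0 fo K0).
  by rewrite mulrC divfK ?gt_eqF// ltxx.
move=> x; rewrite -fo; apply: (connected_const _ conn) => y z byz.
have := le_trans (edge_le_dform y z ff) ff0.
rewrite pmulr_rle0 ?divr_gt0// => H; apply/eqP.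
by rewrite -subr_eq0 -sqrf_eq0 eq_le H sqr_ge0.
Qed.

Lemma point_bounded_transient o : connected_graph b ->
  (forall x, point_bounded x) -> transient b c o.
Proof.
move=> conn pb y.
pose ell phi : R := phi y.
have ellD phi psi a : finitely_supported phi -> finitely_supported psi ->
  ell (fun x => phi x + a * psi x) = ell phi + a * ell psi by [].
have [C CP] := pb y.
(* $2\varphi(y) \le 2\sqrt{|C|D} \le |C| + D$, with [D] the energy of [phi]. *)
have Jm0 phi : finitely_supported phi -> - `|C| <= dform b c phi phi - 2 * ell phi.
  move=> fphi; have := CP _ fphi; rewrite /ell; set D := dform _ _ _ _ => H1.
  have D0 : 0 <= D by apply: dform_ge0 => //; exact: finitely_supported_energy.
  have H2 : phi y ^+ 2 <= `|C| * D by apply: le_trans H1 _; rewrite ler_wpM2r// ler_norm.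
  have K0 := normr_ge0 C; set K := `|C| in H2 K0 *.
  rewrite leNgt; apply/negP => H; have := sqr_ge0 (D - K); nra.
have [m [phi_ [Jm phiP]]] := minimizing_sequence b c ell _ Jm0.
have [G [cvG GD GG LG]] := minimizer graph_bc _ ellD pb _ _ Jm phiP.
(* The minimizing sequence itself approximates [G], in energy and at [o]. *)
have G0 : finite_energy0 b c o G.
  apply/finite_energy0P; split => // e e0.
  have : (fun n => 4 * n.+1%:R^-1 + (G o - phi_ n o) ^+ 2) @ \oo --> 4 * (0 : R) + (G o - G o) ^+ 2.
    apply: cvgD; first by apply: cvgMr; exact: cvg_harmonic.
    by rewrite expr2; apply: cvgM; apply: cvgB => //; exact: cvg_cst.
  rewrite mulr0 subrr expr0n addr0 => /cvgr_lt/(_ e e0)[N _ /(_ N (leqnn N))/= HN].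
  exists (phi_ N); first by have [] := phiP N.
  by rewrite /= mulN1r; apply: le_lt_trans HN; rewrite lerD2r; have [] := GD N.
exists G; split.
  split; [exact: G0|exact (finite_energy_laplacian_domain graph_bc GG)|].
  by move=> x; rewrite LG /ell /delta eq_sym.
(* Uniqueness: [G - G'] is harmonic and lies in $\mathcal{D}_0$, hence vanishes. *)
move=> G' [G'0 G'd LG']; apply/funext => x; apply/eqP; rewrite -subr_eq0 -mulN1r; apply/eqP.
apply: (finite_energy0_harmonic_eq0 (o := o) conn (pb o) (finite_energy0_sub G0 G'0)) => z.
have [G1 G2] := green_delta graph_bc z (finite_energy_laplacian_domain graph_bc GG).
have [G3 G4] := green_delta graph_bc z G'd.
have /finite_energy0P[/(finite_energy_laplacian_domain graph_bc) Hd _] := finite_energy0_sub G0 G'0.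
rewrite -(green_delta graph_bc z Hd).2 dformC dformDr//; try exact: absum_densC.
by rewrite !(dformC b c (delta z)) G2 G4 LG LG' /ell /delta (eq_sym z) mulN1r subrr.
Qed.

(** Green's formula gives $\mathcal{Q}(G_x,\varphi)=\varphi(x)$; by Cauchy-Schwarz the energy of
    $G_x$ serves as the constant. *)
Lemma transient_point_bounded o : transient b c o -> forall x, point_bounded x.
Proof.
move=> tr x; have [G [[G0 Gd LG] _]] := tr x.
have /finite_energy0P[GG _] := G0.
exists (dform b c G G) => phi fphi.
have := dform_cauchy_schwarz graph_bc GG (finitely_supported_energy graph_bc fphi).
rewrite (green graph_bc Gd fphi).2 (tsum_supp1 (x := x)) ?LG ?eqxx ?mulr1//.
by move=> y /negPf yx; rewrite LG yx mulr0.
Qed.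

End Transience.

(** * Bounded harmonic functions *)

Section BoundedHarmonic.
Context {R : realType} {X : countType}.
Variables (b : X -> X -> R) (c : X -> R).
Hypothesis graph_bc : is_graph b c.
Implicit Types f g h phi psi s u : X -> R.

Let b_ge0 x y : 0 <= b x y. Proof. by case: graph_bc. Qed.
Let c_ge0 x : 0 <= c x. Proof. by case: graph_bc. Qed.

Let graph_b0 : is_graph b (cst 0) := is_graph_no_killing graph_bc.

Let killing_ge0 f x : 0 <= c x * f x ^+ 2.
Proof. exact: mulr_ge0 (c_ge0 x) (sqr_ge0 (f x)). Qed.

Lemma dform_killing f : absum (dens b c f f) ->
  dform b c f f = dform b (cst 0) f f + tsum (fun x => c x * f x ^+ 2).
Proof.
move=> ff; pose k (e : (X * X) + X) : R := if e is inr x then c x * f x ^+ 2 else 0.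
have inr_inj : injective (fun x : X => inr (X * X) x) by move=> x y [].
have kr e : ~ range (fun x : X => inr (X * X) x) e -> k e = 0.
  by case: e => // x nx; exfalso; apply: nx; exists x.
have ks : absum k.
  apply: absum_le ff _ => -[p|x]; rewrite /= ?normr0 ?(dens_ge0 graph_bc)//.
  by rewrite ger0_norm ?killing_ge0// /dens/= expr2.
have f0 : absum (dens b (cst 0) f f).
  apply: absum_le ff _ => e; rewrite ger0_norm ?(dens_ge0 graph_b0)//.
  case: e => //= x; rewrite /dens/= mul0r; exact: (dens_ge0 graph_bc f (inr x)).
rewrite (_ : (fun x => _) = k \o (fun x : X => inr (X * X) x))// -tsum_embed//.
rewrite /dform -tsumD//; congr tsum; apply/funext => -[p|x].
  by rewrite /= addr0.
by rewrite /dens /= mul0r add0r expr2.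
Qed.

Lemma absum_killing f : absum (dens b c f f) -> absum (fun x => c x * f x ^+ 2).
Proof.
have inr_inj : injective (fun x : X => inr (X * X) x) by move=> x y [].
by move=> /(absum_comp _ inr_inj).
Qed.

Lemma dform_killing_ge f : absum (dens b c f f) ->
  dform b (cst 0) f f <= dform b c f f.
Proof.
move=> ff; rewrite dform_killing// lerDl tsum_ge0//; exact: absum_killing.
Qed.

Lemma laplacian_cst0 f x : laplacian b (cst 0) f x = tsum (fun y => b x y * (f x - f y)).
Proof. by rewrite /laplacian mul0r addr0. Qed.

(* The ground state transform: test the superharmonic s against phi^2 / s. *)
Lemma superharmonic_point_bounded s M x : (forall y, 1 <= s y <= M) ->
  (forall y, 0 <= laplacian b (cst 0) s y) -> 0 < laplacian b (cst 0) s x ->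
  point_bounded b (cst 0) x.
Proof.
move=> sM Ls Lsx.
have s1 y : 1 <= s y by case/andP: (sM y).
have s0 y : 0 < s y by exact: lt_le_trans (s1 y).
have sd : laplacian_domain b s.
  apply: (bounded_laplacian_domain graph_bc s M) => y.
  by rewrite ger0_norm; [case/andP: (sM y)|exact: ltW].
exists (s x / laplacian b (cst 0) s x) => phi fphi.
pose psi y := phi y ^+ 2 / s y.
have fpsi : finitely_supported psi.
  by apply: finitely_supported_sub fphi _ => y phi0; rewrite /psi phi0 expr0n mul0r.
have [spsi dE] := green graph_b0 sd fpsi.
have sphi := finitely_supported_energy graph_b0 fphi.
have psi_ge0 y : 0 <= psi y by rewrite divr_ge0 ?sqr_ge0 ?ltW.
have le1 : psi x * laplacian b (cst 0) s x <= dform b (cst 0) s psi.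
  rewrite dE; apply: (ler_term_tsum (fun y => psi y * laplacian b (cst 0) s y)).
    apply: finitely_supported_absum; apply: finitely_supported_sub fpsi _ => y ->.
    by rewrite mul0r.
  by move=> y; rewrite mulr_ge0.
(* Picone's inequality, edge by edge: the difference of the two terms is the weight times
   $(s(z)\varphi(y)-s(y)\varphi(z))^2/(s(y)s(z))$. *)
have le2 : dform b (cst 0) s psi <= dform b (cst 0) phi phi.
  apply: ler_tsum => // -[[y z]|y]; last by rewrite /dens/= !mul0r.
  rewrite /dens/= ler_wpM2l ?divr_ge0// /psi.
  have := s0 y; have := s0 z; move: (s y) (s z) (phi y) (phi z) => p q a e q0 p0.
  rewrite -subr_ge0 (_ : _ - _ = (q * a - p * e) ^+ 2 / (p * q)).
    by rewrite divr_ge0 ?sqr_ge0// mulr_ge0 ?ltW.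
  by field; rewrite !gt_eqF.
have -> : phi x ^+ 2 =
    s x / laplacian b (cst 0) s x * (psi x * laplacian b (cst 0) s x).
  by rewrite /psi; field; rewrite !gt_eqF.
by rewrite ler_wpM2l ?(le_trans le1)// divr_ge0// ltW.
Qed.

Lemma bounded_harmonic_transient o u : connected_graph b ->
  (exists x, c x != 0) -> harmonic_fun b c u -> bounded_fun u ->
  (exists x, u x != 0) -> transient b (cst 0) o.
Proof.
move=> conn [x0 cx0] [ud Lu] ub [x1 ux1].
have [M uM] : exists M, forall x, `|u x| <= M.
  by have [M [_ uM]] := ub; exists (M + 1) => x; apply: uM; rewrite ?ltrDl.
have M0 : 0 <= M := le_trans (normr_ge0 _) (uM x1).
have u2M x : u x ^+ 2 <= M ^+ 2.
  by rewrite -(real_normK (num_real (u x))) lerXn2r ?nnegrE.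
(* The summand 1 keeps [s] at least 1, so that division by [s] is harmless. *)
pose s x := M ^+ 2 + 1 - u x ^+ 2.
have sM x : 1 <= s x <= M ^+ 2 + 1.
  by rewrite /s; have := u2M x; have := sqr_ge0 (u x); lra.
pose e x y := b x y * (u x - u y) ^+ 2.
have e_ge0 x y : 0 <= e x y := mulr_ge0 (b_ge0 x y) (sqr_ge0 _).
have es x : absum (e x).
  apply: absum_le (absumZ (4 * M ^+ 2) (absum_weight graph_bc x)) _ => y.
  rewrite ger0_norm// /e mulrC ler_wpM2r//.
  have := u2M x; have := u2M y; have := sqr_ge0 (u x + u y); nra.
(* Uses $u(y)^2-u(x)^2=(u(x)-u(y))^2-2u(x)(u(x)-u(y))$; harmonicity of [u] turns the sum of the last
   terms into the killing term. *)
have Ls x : laplacian b (cst 0) s x = tsum (e x) + 2 * c x * u x ^+ 2.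
  have us := absum_laplacian graph_bc ud x.
  have := Lu x; rewrite laplacian_cst0 /laplacian => Lx.
  rewrite (_ : (fun y => _) = fun y => e x y - 2 * u x * (b x y * (u x - u y))).
    rewrite tsumB//; last exact: absumZ.
    rewrite tsumZ//; move/eqP: Lx; rewrite addr_eq0 => /eqP ->; ring.
  by apply/funext => y; rewrite /e /s; ring.
have Ls_ge0 x : 0 <= laplacian b (cst 0) s x.
  by rewrite Ls addr_ge0 ?tsum_ge0// -mulrA mulr_ge0// killing_ge0.
have [x Lx] : exists x, 0 < laplacian b (cst 0) s x.
  (* Otherwise every edge term vanishes, so [u] is constant, and [c x0 * u x0 ^ 2 = 0] forces this
     constant to be 0. *)
  apply: contrapT => /forallNP nL.
  have L0 x : tsum (e x) = 0 /\ c x * u x ^+ 2 = 0.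
    have := nL x; move/negP; rewrite -leNgt Ls.
    have := tsum_ge0 _ (es x) (e_ge0 x); have := killing_ge0 u x.
    by split; lra.
  have uconst : forall x y, u x = u y.
    apply: (connected_const _ conn) => x y bxy; apply/eqP.
    rewrite -subr_eq0 -sqrf_eq0 eq_le sqr_ge0 andbT -(pmulr_rle0 _ bxy).
    by rewrite -(L0 x).1; apply: (ler_term_tsum (e x)).
  have [_ /eqP] := L0 x0; rewrite mulf_eq0 (negPf cx0) sqrf_eq0 /= (uconst x0 x1).
  by rewrite (negPf ux1).
apply: (point_bounded_transient graph_b0) => //.
apply: (point_bounded_connected graph_b0 conn (x := x)).
exact: superharmonic_point_bounded sM Ls_ge0 Lx.
Qed.

(** Killing only raises the energy, so the capacity inequality passes from [b] to [(b, c)];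
    summability of [c] bounds the functional from below. *)
Lemma transient_bounded_harmonic o : transient b (cst 0) o -> absum c ->
  exists u, [/\ harmonic_fun b c u, bounded_fun u & exists x, u x != 0].
Proof.
move=> tr cs; have pb0 := transient_point_bounded graph_b0 tr.
have pb x : point_bounded b c x.
  have [C CP] := pb0 x; exists `|C| => phi fphi.
  have H0 := finitely_supported_energy graph_b0 fphi.
  have H1 := finitely_supported_energy graph_bc fphi.
  apply: le_trans (CP _ fphi) _.
  apply: le_trans (ler_wpM2r (dform_ge0 graph_b0 H0) (ler_norm C)) _.
  by rewrite ler_wpM2l// dform_killing_ge.
pose ell phi := tsum (fun x => c x * phi x).
have cphi phi : finitely_supported phi -> absum (fun x => c x * phi x).
  move=> fphi; apply: finitely_supported_absum; apply: finitely_supported_sub fphi _ => x ->.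
  by rewrite mulr0.
have ellD phi psi a : finitely_supported phi -> finitely_supported psi ->
    ell (fun x => phi x + a * psi x) = ell phi + a * ell psi.
  move=> fphi fpsi; rewrite /ell -(tsumZ a (cphi _ fpsi)).
  rewrite -(tsumD (cphi _ fphi) (absumZ a (cphi _ fpsi))).
  by congr tsum; apply/funext => x; ring.
(* Since $t^2-2t=(1-t)^2-1$, this is the killing energy density of [1 - phi] minus [c]; hence the
   lower bound [- tsum c] on the functional. *)
pose w phi x := c x * (phi x ^+ 2 - 2 * phi x).
have ws phi : finitely_supported phi -> absum (w phi).
  move=> fphi; apply: finitely_supported_absum; apply: finitely_supported_sub fphi _ => x x0.
  by rewrite /w x0; ring.
have JE phi : finitely_supported phi ->
    dform b c phi phi - 2 * ell phi = dform b (cst 0) phi phi + tsum (w phi).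
  move=> fphi; have ephi := finitely_supported_energy graph_bc fphi.
  rewrite dform_killing// -addrA; congr (_ + _).
  rewrite /ell -(tsumZ 2 (cphi _ fphi)).
  rewrite -(tsumB (absum_killing ephi) (absumZ 2 (cphi _ fphi))).
  by congr tsum; apply/funext => x; rewrite /w; ring.
have Jm0 phi : finitely_supported phi -> - tsum c <= dform b c phi phi - 2 * ell phi.
  move=> fphi; rewrite JE//.
  have := dform_ge0 graph_b0 (finitely_supported_energy graph_b0 fphi).
  have : - tsum c <= tsum (w phi).
    rewrite -tsumN// ler_tsum//; [exact: absumN|exact: ws|].
    by move=> x; have := sqr_ge0 (phi x - 1); have := c_ge0 x; rewrite /w; nra.
  lra.
have [m [psi_ [Jm psiP]]] := minimizing_sequence b c ell _ Jm0.
pose tr01 (r : R) := Num.max 0 (Num.min 1 r).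
have tr01_itv r : 0 <= tr01 r <= 1.
  by rewrite /tr01 le_max lexx /= ge_max ler01 ge_min lexx.
have tr01E r : [\/ r <= 0 /\ tr01 r = 0, [/\ 0 <= r, r <= 1 & tr01 r = r] | 1 <= r /\ tr01 r = 1].
  rewrite /tr01; have [r1|/ltW r1] := leP 1 r; first by rewrite max_r//; exact: Or33.
  have [r0|/ltW r0] := leP r 0; first exact: Or31.
  exact: Or32.
have tr01_mono r t : t <= r -> 0 <= tr01 r - tr01 t <= r - t.
  by case: (tr01E r) => [[r0 ->]|[r0 r1 ->]|[r1 ->]];
    case: (tr01E t) => [[t0 ->]|[t0 t1 ->]|[t1 ->]]; lra.
have tr01_contr r t : (tr01 r - tr01 t) ^+ 2 <= (r - t) ^+ 2.
  wlog rt : r t / t <= r => [H|].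
    have [/H//|/ltW/H] := leP t r.
    by rewrite -sqrrN opprB -[leRHS]sqrrN opprB.
  by have /andP[d0 d1] := tr01_mono _ _ rt; rewrite lerXn2r ?nnegrE ?(le_trans d0).
(* Truncation to [0, 1] does not increase the distance to 1. *)
have tr01_sqr r : tr01 r ^+ 2 - 2 * tr01 r <= r ^+ 2 - 2 * r.
  by case: (tr01E r) => [[r0 ->]|[r0 r1 ->]|[r1 ->]]; nra.
(* Truncating to [0, 1] does not increase J. *)
pose phi_ n x := tr01 (psi_ n x).
have phiP n : finitely_supported (phi_ n) /\
    dform b c (phi_ n) (phi_ n) - 2 * ell (phi_ n) <= m + n.+1%:R^-1.
  have [fpsi Jpsi] := psiP n.
  have fphi : finitely_supported (phi_ n).
    apply: finitely_supported_sub fpsi _ => x; rewrite /phi_ => ->.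
    by rewrite /tr01 min_r ?maxxx.
  split; first exact: fphi.
  apply: le_trans Jpsi; rewrite (JE _ fphi) (JE _ fpsi).
  apply: lerD; [rewrite /dform|]; apply: ler_tsum.
  - exact (finitely_supported_energy graph_b0 fphi).
  - exact (finitely_supported_energy graph_b0 fpsi).
  - case=> [p|x]; last by rewrite /dens /= !mul0r.
    by rewrite /dens /= -!expr2 ler_wpM2l ?divr_ge0//; exact: tr01_contr.
  - exact: ws.
  - exact: ws.
  - by move=> x; rewrite ler_wpM2l//; exact: tr01_sqr.
have [g [cvg_g gD gg Lg]] := minimizer graph_bc _ ellD pb _ _ Jm phiP.
have g01 x : 0 <= g x <= 1.
  have cv : cvgn (phi_ ^~ x) by apply/cvg_ex; exists (g x).
  rewrite -(cvg_lim _ (cvg_g x))//; apply/andP; split.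
    by apply: limr_ge => //; apply: nearW => n; case/andP: (tr01_itv (psi_ n x)).
  by apply: limr_le => //; apply: nearW => n; case/andP: (tr01_itv (psi_ n x)).
pose one : X -> R := fun=> 1.
pose u x := one x + -1 * g x.
have u1 x : `|u x| <= 1.
  by rewrite /u /one ler_norml; case/andP: (g01 x); lra.
have oned : laplacian_domain b one.
  by apply: (bounded_laplacian_domain graph_bc one 1) => x; rewrite normr1.
have ud : laplacian_domain b u by exact: bounded_laplacian_domain graph_bc u 1 u1.
exists u; split.
(* The Laplacian of the constant 1 is [c], and that of [g] is [ell (delta x) = c x]; they cancel. *)
- split=> // x; rewrite -(green_delta graph_bc x ud).2.
  have [d1 d2] := green_delta graph_bc x oned.
  have [d3 d4] := green_delta graph_bc x (finite_energy_laplacian_domain graph_bc gg).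
  rewrite dformC dformDr; [|exact: absum_densC..].
  rewrite !(dformC _ _ (delta x)) d2 d4 Lg /laplacian tsum_eq0 => [|y]; last by rewrite subrr mulr0.
  rewrite add0r /ell (tsum_supp1 (x := x)); last first.
    by move=> y /negPf yx; rewrite /delta yx mulr0.
  by rewrite /delta eqxx mulr1 mulN1r subrr.
- exists 1; split; first exact: num_real.
  by move=> M M1 x _; apply: le_trans (u1 x) (ltW M1).
apply: contrapT => /forallNP nu.
have g1 x : g x = 1.
  have := nu x; move/negP; rewrite negbK /u /one mulN1r subr_eq0 => /eqP <-//.
have [C CP] := pb0 o.
(* When [g] is 1, [phi_ n] and [g - phi_ n] have the same energy for [b], at most [4 / (n + 1)].
   Thus [phi_ n o] tends to 0, while it also tends to [g o = 1]. *)
have small n : phi_ n o ^+ 2 <= `|C| * 4 * n.+1%:R^-1.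
  have [fphi _] := phiP n; have [hn hle] := gD n.
  apply: le_trans (CP _ fphi) _.
  have H0 := dform_ge0 graph_b0 (finitely_supported_energy graph_b0 fphi).
  apply: le_trans (ler_wpM2r H0 (ler_norm C)) _; rewrite -mulrA ler_wpM2l//.
  apply: le_trans hle; apply: le_trans (dform_killing_ge hn).
  rewrite le_eqVlt; apply/orP; left; apply/eqP; congr tsum; apply/funext => -[p|x].
    by rewrite /dens /= !g1; ring.
  by rewrite /dens /= !mul0r.
have c1 : (fun n => phi_ n o ^+ 2) @ \oo --> g o ^+ 2.
  by rewrite expr2; apply: cvgM.
have c2 : (fun n => `|C| * 4 * n.+1%:R^-1) @ \oo --> `|C| * 4 * (0 : R).
  by apply: cvgMr; exact: cvg_harmonic.
have : g o ^+ 2 <= `|C| * 4 * 0 by apply: (ler_cvg_to c1 c2); exact: nearW small.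
by rewrite g1 mulr0 expr1n ler10.
Qed.

End BoundedHarmonic.

Unset Implicit Arguments.

Theorem theorem23 (R : realType) (X : countType) (o : X)
    (b : X -> X -> R) (c : X -> R)
    (graph_bc : is_graph b c) (connected_b : connected_graph b) :
  (recurrent b (cst 0) o -> (exists x, c x != 0) ->
     forall u : X -> R, harmonic_fun b c u -> bounded_fun u -> forall x, u x = 0)
  /\
  (transient b (cst 0) o -> summable [set: X] (EFin \o c) ->
     exists u : X -> R, [/\ harmonic_fun b c u, bounded_fun u & exists x, u x != 0]).
Proof.
split; last exact: transient_bounded_harmonic.
move=> rec c0 u hu ub x; apply/eqP; apply: contrapT => /negP ux.
by apply: rec; apply: (bounded_harmonic_transient graph_bc _ connected_b c0 hu ub); exists x.
Qed.
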